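(* On the Hull-compatible configuration space, $W_{\mathrm{Courant},G_2}=W_{\rm ext}$, where $$W_{\mathrm{Courant},G_2}=\int_Y\varrho\,\beta_\Delta(\chi,{\not\!\!D}^+\chi),\qquad W_{\rm ext}=\int_Y\Bigl[\beta_\Delta(\zeta,D_g\zeta)+\tfrac14\beta_\Delta(\zeta,H\cdot\zeta)\Bigr]\mathrm{vol}_g,\quad\zeta=e^{-\Phi}\chi.$$
   Context: A Hull-compatible configuration on a spin $7$-manifold $Y$ (an admissible metric on a fixed string Courant algebroid, with spinor line and positive density, whose tangent connection component is the metric connection $\nabla^g-\frac12g^{-1}H$) determines a Riemannian metric $g$, a three-form flux $H$, a local unit real spinor $\chi$ (up to sign) in the real spinor bundle of $g$, and a positive density $\varrho=e^{-2\Phi}\mathrm{vol}_g$, which defines the dilaton $\Phi$. $\beta_\Delta$ is the symmetric invariant pairing on real spinors. Clifford multiplication $c_g$ satisfies $c_g(X)c_g(Y)+c_g(Y)c_g(X)=-2g(X,Y)$, is extended to forms by $c_g(e^{1}\wedge\cdots\wedge e^{p})=c_g(e^1)\cdots c_g(e^p)$ on orthogonal covectors, and $\alpha\cdot\chi=c_g(\alpha)\chi$; one-form Clifford multiplication is skew-adjoint for $\beta_\Delta$. $D_g$ is the Levi-Civita Dirac operator. ${\not\!\!D}^+$ is the canonical positive generalized Dirac operator associated with the admissible metric and the divergence of $\varrho$, given in the induced splitting by ${\not\!\!D}^+=D_g+\frac14c_g(H)-\frac12c_g(\vartheta)$, $\vartheta=2\,d\Phi$. *)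

(* Defs.v *)
From HB Require Import structures.
From mathcomp Require Import all_boot all_order all_algebra.
From mathcomp Require Import all_classical all_reals all_analysis.

Set Implicit Arguments.
Unset Strict Implicit.
Unset Printing Implicit Defensive.

Import Order.TTheory GRing.Theory Num.Theory.
Import numFieldNormedType.Exports.

Local Open Scope classical_set_scope.
Local Open Scope ring_scope.

(* Conventions.
   - Vectors are columns.  A point y has a preferred chart (the first one in a
     countable atlas whose domain contains y), and T_y is R^7 read in that
     chart; fibres of other bundles are likewise read in a preferred local
     trivialization.  Smoothness is always tested in all charts and all
     trivializations.
   - Fields and sections are total functions; those over an open set U are
     functions that are smooth on U, and only their values on U matter. *)

Section Euclidean.
Context {R : realType}.

Definition partial n (V : normedModType R) (i : 'I_n) (f : 'cV[R]_n -> V) :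
  'cV[R]_n -> V := fun x => 'D_(delta_mx i 0) f x.

(* C^oo on the open set O: every iterated partial derivative is differentiable
   at every point of O *)
Definition smooth_on n (V : normedModType R) (O : set 'cV[R]_n)
    (f : 'cV[R]_n -> V) :=
  forall s : seq 'I_n, forall x, O x ->
    differentiable (foldr (@partial n V) f s) x.

(* Lebesgue integral over R^n of a nonnegative Borel function, as an iterated
   integral (Tonelli) *)
Fixpoint lebint n : ('cV[R]_n -> \bar R) -> \bar R :=
  match n return ('cV[R]_n -> \bar R) -> \bar R with
  | 0 => fun h => h 0
  | k.+1 => fun h =>
      (\int[@lebesgue_measure R]_t
         lebint (fun v : 'cV[R]_k => h (col_mx (t%:M : 'cV[R]_1) v)))%E
  end.

End Euclidean.

Record manifold (R : realType) := Manifold {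
  mpoint :> topologicalType;
  mhausdorff : hausdorff_space mpoint;
  cdom : nat -> set mpoint;
  chart : nat -> mpoint -> 'cV[R]_7;
  cinv : nat -> 'cV[R]_7 -> mpoint;
  cdom_open : forall k, open (cdom k);
  cdom_cover : forall y, exists k, cdom k y;
  chart_open : forall k, open (chart k @` cdom k);
  chartK : forall k y, cdom k y -> cinv k (chart k y) = y;
  chart_continuous : forall k y, cdom k y -> {for y, continuous (chart k)};
  cinv_continuous : forall k x, (chart k @` cdom k) x ->
    {for x, continuous (cinv k)};
  chart_smooth : forall j k,
    smooth_on (chart j @` (cdom j `&` cdom k)) (chart k \o cinv j)
}.

Arguments mhausdorff {R} Y : rename.
Arguments cdom {R Y} k : rename.
Arguments chart {R Y} k : rename.
Arguments cinv {R Y} k : rename.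

Section Manifold.
Context {R : realType} {Y : manifold R}.

Lemma cat_subproof (y : Y) : exists k, `[< cdom k y >].
Proof. by case: (cdom_cover y) => k yk; exists k; apply/asboolP. Qed.

(* index of the preferred chart at y *)
Definition cat (y : Y) : nat := ex_minn (cat_subproof y).

Definition smooth (V : normedModType R) (U : set Y) (f : Y -> V) :=
  forall k, smooth_on (chart k @` (U `&` cdom k)) (f \o cinv k).

(* derivative of f at y along v \in T_y *)
Definition dfun (V : normedModType R) (f : Y -> V) (y : Y) (v : 'cV[R]_7) : V :=
  'D_v (f \o cinv (cat y)) (chart (cat y) y).

(* A density is given by its component in the preferred chart at each point.
   Its integral is the sum, over the countable Borel partition of Y into the
   sets where a given chart is preferred, of the Lebesgue integrals of these
   components, taken separately for the positive and the negative part. *)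
Definition integral_ge0 (h : Y -> \bar R) : \bar R :=
  (\sum_(0 <= k <oo)
     lebint (fun x => h (cinv k x) *
                      (\1_(chart k @` [set y | cat y = k]) x)%:E))%E.

Definition integral_density (f : Y -> R) : \bar R :=
  (integral_ge0 (EFin \o f)^\+ - integral_ge0 (EFin \o f)^\-)%E.

End Manifold.

(* Vector bundles of rank n.  [btrans B i j y] turns coordinates in the
   trivialization j into coordinates in the trivialization i. *)
Record bundle_data (R : realType) (Y : manifold R) (n : nat) := BundleData {
  bidx : Type;
  bdom : bidx -> set Y;
  btriv : Y -> bidx;
  btrans : bidx -> bidx -> Y -> 'M[R]_n
}.

Arguments bidx {R Y n} B : rename.
Arguments bdom {R Y n} B j : rename.
Arguments btriv {R Y n} B y : rename.
Arguments btrans {R Y n} B i j y : rename.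

Section Bundles.
Context {R : realType} {Y : manifold R}.

Definition section n (B : bundle_data Y n) := Y -> 'cV[R]_n.

Definition is_bundle n (B : bundle_data Y n) : Prop :=
  [/\ forall j, open (bdom B j),
      forall y, bdom B (btriv B y) y,
      forall i j, smooth (bdom B i `&` bdom B j) (btrans B i j),
      forall i y, bdom B i y -> btrans B i i y = 1%:M &
      forall i j k y, bdom B i y -> bdom B j y -> bdom B k y ->
        btrans B i j y *m btrans B j k y = btrans B i k y].

(* the section s read in the trivialization j *)
Definition loc n (B : bundle_data Y n) (j : bidx B) (s : section B) :
    Y -> 'cV[R]_n :=
  fun z => btrans B j (btriv B z) z *m s z.

Definition bsmooth n (B : bundle_data Y n) (U : set Y) (s : section B) :=
  forall j, smooth (U `&` bdom B j) (loc j s).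

Arguments bsmooth {n} B U s.

(* extension of u \in B_y that is constant in the preferred trivialization
   at y *)
Definition flat n (B : bundle_data Y n) (y : Y) (u : 'cV[R]_n) : section B :=
  fun z => btrans B (btriv B z) (btriv B y) z *m u.

Definition happ n n' (M : Y -> 'M[R]_(n', n)) (s : Y -> 'cV[R]_n) :
    Y -> 'cV[R]_n' := fun y => M y *m s y.

Definition hom_smooth n n' (B : bundle_data Y n) (B' : bundle_data Y n')
    (M : Y -> 'M[R]_(n', n)) :=
  forall U (s : section B), open U -> bsmooth B U s ->
    bsmooth B' U (happ M s).

Definition form n (Q : Y -> 'M[R]_n) (s t : Y -> 'cV[R]_n) : Y -> R :=
  fun y => ((s y)^T *m Q y *m t y) 0 0.

Definition form_smooth n (B : bundle_data Y n) (Q : Y -> 'M[R]_n) :=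
  forall U (s t : section B), open U -> bsmooth B U s -> bsmooth B U t ->
    smooth U (form Q s t : Y -> R).

(* tangent bundle: transition matrices are the Jacobians of the changes of
   charts *)
Definition TY : bundle_data Y 7 :=
  @BundleData R Y 7 nat cdom cat
    (fun i j y => \matrix_(a, b)
       ('D_(delta_mx b 0) (@chart R Y i \o @cinv R Y j) (chart j y)) a 0).

Definition vfield := section TY.

Definition lie (X Z : vfield) : vfield := fun y =>
  dfun (loc (cat y : bidx TY) Z) y (X y) -
  dfun (loc (cat y : bidx TY) X) y (Z y).

(* Leibniz algebroids: the common part of Lie and Courant algebroids *)
Record leibniz_algebroid n (B : bundle_data Y n) := LeibnizAlgebroid {
  l_bundle : is_bundle B;
  anchor : Y -> 'M[R]_(7, n);
  anchor_smooth : hom_smooth B TY anchor;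
  brk : section B -> section B -> section B;
  brk_smooth : forall U a b, open U -> bsmooth B U a -> bsmooth B U b ->
    bsmooth B U (brk a b);
  brk_local : forall U a a' b b', open U ->
    bsmooth B U a -> bsmooth B U b ->
    {in U, a =1 a'} -> {in U, b =1 b'} -> {in U, brk a b =1 brk a' b'};
  brk_leibniz : forall U (f : Y -> R) a b b', open U -> smooth U (f : Y -> R) ->
    bsmooth B U a -> bsmooth B U b -> bsmooth B U b' ->
    forall y, U y ->
      brk a (fun z => f z *: b z + b' z) y =
      f y *: brk a b y + dfun f y (anchor y *m a y) *: b y + brk a b' y;
  brk_jacobi : forall U a b c, open U ->
    bsmooth B U a -> bsmooth B U b -> bsmooth B U c ->
    forall y, U y ->
      brk a (brk b c) y = brk (brk a b) c y + brk b (brk a c) y;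
  brk_anchor : forall U a b, open U -> bsmooth B U a -> bsmooth B U b ->
    forall y, U y ->
      anchor y *m brk a b y = lie (happ anchor a) (happ anchor b) y
}.

Definition transitive_alg n (B : bundle_data Y n) (A : leibniz_algebroid B) :=
  forall y, row_free (anchor A y).

Record lie_algebroid n (B : bundle_data Y n) := LieAlgebroid {
  lie_leibniz :> leibniz_algebroid B;
  lie_skew : forall U a b, open U -> bsmooth B U a -> bsmooth B U b ->
    forall y, U y -> brk lie_leibniz a b y = - brk lie_leibniz b a y
}.

Record courant_algebroid n (B : bundle_data Y n) := CourantAlgebroid {
  c_leibniz :> leibniz_algebroid B;
  pairing : Y -> 'M[R]_n;
  pairing_smooth : form_smooth B pairing;
  pairing_sym : forall y, (pairing y)^T = pairing y;
  pairing_nondeg : forall y, pairing y \in unitmx;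
  pairing_inv : forall U a b c, open U ->
    bsmooth B U a -> bsmooth B U b -> bsmooth B U c ->
    forall y, U y ->
      dfun (form pairing b c) y (anchor c_leibniz y *m a y) =
      form pairing (brk c_leibniz a b) c y +
      form pairing b (brk c_leibniz a c) y;
  pairing_brk : forall U a b c, open U ->
    bsmooth B U a -> bsmooth B U b -> bsmooth B U c ->
    forall y, U y ->
      form pairing (fun z => brk c_leibniz a b z + brk c_leibniz b a z) c y =
      dfun (form pairing a b) y (anchor c_leibniz y *m c y)
}.

(* the embedding T^*Y -> E, normalized by <cotan xi, e> = xi(anchor e) / 2 *)
Definition cotan n (B : bundle_data Y n) (E : courant_algebroid B) (y : Y) :
    'M[R]_(n, 7) :=
  2^-1 *: (invmx (pairing E y) *m (anchor E y)^T).

(* A string Courant algebroid over the fibre product of the frame bundle of TY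
   and a gauge bundle: E / T^*Y is identified with the fibre product over TY of
   the Atiyah algebroid of the frame bundle (first-order operators on vector
   fields with scalar symbol) and of the Atiyah algebroid A of the gauge
   bundle.  [act] and [toA] are the two components of E -> E / T^*Y. *)
Record string_algebroid n (B : bundle_data Y n) m (G : bundle_data Y m) :=
  StringAlgebroid {
  s_courant :> courant_algebroid B;
  s_transitive : transitive_alg s_courant;
  gauge : lie_algebroid G;
  toA : Y -> 'M[R]_(m, n);
  toA_smooth : hom_smooth B G toA;
  toA_anchor : forall y, anchor gauge y *m toA y = anchor s_courant y;
  toA_brk : forall U a b, open U -> bsmooth B U a -> bsmooth B U b ->
    forall y, U y ->
      toA y *m brk s_courant a b y = brk gauge (happ toA a) (happ toA b) y;
  act : section B -> vfield -> vfield;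
  act_smooth : forall U a X, open U -> bsmooth B U a -> bsmooth TY U X ->
    bsmooth TY U (act a X);
  act_local : forall U a a' X X', open U -> bsmooth B U a -> bsmooth TY U X ->
    {in U, a =1 a'} -> {in U, X =1 X'} -> {in U, act a X =1 act a' X'};
  act_linear : forall U (f : Y -> R) a b X, open U -> smooth U (f : Y -> R) ->
    bsmooth B U a -> bsmooth B U b -> bsmooth TY U X ->
    forall y, U y ->
      act (fun z => f z *: a z + b z) X y = f y *: act a X y + act b X y;
  act_leibniz : forall U (f : Y -> R) a X Z, open U -> smooth U (f : Y -> R) ->
    bsmooth B U a -> bsmooth TY U X -> bsmooth TY U Z ->
    forall y, U y ->
      act a (fun z => f z *: X z + Z z) y =
      f y *: act a X y + dfun f y (anchor s_courant y *m a y) *: X y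
      + act a Z y;
  act_brk : forall U a b X, open U ->
    bsmooth B U a -> bsmooth B U b -> bsmooth TY U X ->
    forall y, U y ->
      act (brk s_courant a b) X y = act a (act b X) y - act b (act a X) y;
  s_exact : forall U a, open U -> bsmooth B U a -> forall y, U y ->
    [/\ anchor s_courant y *m a y = 0, toA y *m a y = 0 &
        forall X, bsmooth TY U X -> act a X y = 0] <->
    exists xi : 'cV[R]_7, a y = cotan s_courant y *m xi;
  s_onto : forall y (w : 'cV[R]_m) (T : 'M[R]_7), anchor gauge y *m w = 0 ->
    exists U a, [/\ open U, U y, bsmooth B U a, toA y *m a y = w &
      forall X, bsmooth TY U X -> act a X y = T *m X y]
}.

(* Levi-Civita connection of g, from the Koszul formula: [koszul g X Z W] is
   g(nabla_X Z, W) *)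
Definition koszul (g : Y -> 'M[R]_7) (X Z W : vfield) : Y -> R := fun y =>
  2^-1 * (dfun (form g Z W) y (X y) + dfun (form g X W) y (Z y)
          - dfun (form g X Z) y (W y)
          + form g (lie X Z) W y - form g (lie X W) Z y - form g (lie Z W) X y).

Definition levi_civita (g : Y -> 'M[R]_7) (X Z : vfield) : vfield := fun y =>
  invmx (g y) *m \col_i koszul g X Z (flat TY y (delta_mx i 0)) y.

(* admissible metrics: subbundles V_+ of E on which the pairing is positive
   definite and the anchor is an isomorphism onto TY, described by the inverse
   isomorphism [splus] : TY -> V_+ *)
Record admissible_metric n (B : bundle_data Y n) (E : courant_algebroid B) :=
  AdmissibleMetric {
  splus : Y -> 'M[R]_(n, 7);
  splus_smooth : hom_smooth TY B splus;
  splus_anchor : forall y, anchor E y *m splus y = 1%:M;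
  splus_pos : forall y (v : 'cV[R]_7), v != 0 ->
    0 < ((splus y *m v)^T *m pairing E y *m (splus y *m v)) 0 0
}.

Section AdmissibleMetric.
Context n (B : bundle_data Y n) (E : courant_algebroid B).
Variable V : admissible_metric E.

Definition metric (y : Y) : 'M[R]_7 :=
  (splus V y)^T *m pairing E y *m splus V y.

(* the isotropic splitting TY -> E induced by V_+, so that
   V_+ = {splitting X + cotan (g X)} *)
Definition splitting (y : Y) : 'M[R]_(n, 7) :=
  splus V y - cotan E y *m metric y.

(* H(X, Z, W) = 2 <[sX, sZ], sW> for s the induced splitting *)
Definition flux (y : Y) (u v w : 'cV[R]_7) : R :=
  2 * form (pairing E)
        (brk E (happ splitting (flat TY y u))
               (happ splitting (flat TY y v)))
        (fun=> splitting y *m w) y.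

End AdmissibleMetric.

End Bundles.

Arguments TY {R} Y.
Arguments vfield {R} Y.
Arguments bsmooth {R Y n} B U s.

Section Spin.
Context {R : realType}.

(* real spinor module of Cl_7 (v^2 = -|v|^2) with its invariant pairing *)
Record spinor_module := SpinorModule {
  gam : 'I_7 -> 'M[R]_8;
  gam_clifford : forall a b,
    gam a *m gam b + gam b *m gam a = (- 2 * (a == b)%:R)%:M;
  bet : 'M[R]_8;
  bet_sym : bet^T = bet;
  bet_pos : forall u : 'cV[R]_8, u != 0 -> 0 < (u^T *m bet *m u) 0 0;
  gam_skew : forall a, (gam a)^T *m bet = - (bet *m gam a)
}.

Definition beta (D : spinor_module) (u v : 'cV[R]_8) : R :=
  (u^T *m bet D *m v) 0 0.

Definition cliff (D : spinor_module) (v : 'cV[R]_7) : 'M[R]_8 :=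
  \sum_a v a 0 *: gam D a.

(* image of Spin(7) in GL_8: products of an even number of unit vectors *)
Definition spin7 (D : spinor_module) (s : 'M[R]_8) : Prop :=
  exists l : seq 'cV[R]_7,
    [/\ ~~ odd (size l), {in l, forall v, (v^T *m v) 0 0 = 1} &
        s = \big[mulmx/1%:M]_(v <- l) cliff D v].

Context {Y : manifold R}.

(* spin structure of (Y, g), given through its spinor bundle: in each
   trivialization there is an orthonormal frame, and the transition functions
   are Spin(7)-valued lifts of the changes of frames *)
Record spin_structure (D : spinor_module) (g : Y -> 'M[R]_7) := SpinStructure {
  spinors : bundle_data Y 8;
  sp_bundle : is_bundle spinors;
  frame : bidx spinors -> 'I_7 -> vfield Y;
  frame_smooth : forall j a, bsmooth (TY Y) (bdom spinors j) (frame j a);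
  frame_on : forall j a b y, bdom spinors j y ->
    form g (frame j a) (frame j b) y = (a == b)%:R;
  sp_trans : forall i j y, bdom spinors i y -> bdom spinors j y ->
    spin7 D (btrans spinors i j y) /\
    forall a, btrans spinors i j y *m gam D a =
      \sum_b form g (frame j a) (frame i b) y *: (gam D b *m btrans spinors i j y)
}.

Section Dirac.
Variables (D : spinor_module) (g : Y -> 'M[R]_7) (S : spin_structure D g).

Definition spinor_field := section (spinors S).

Definition frame_at (y : Y) : 'I_7 -> vfield Y := frame (btriv (spinors S) y).

(* D_g psi = sum_a e_a . (e_a psi + 1/4 sum_bc g(nabla_a e_b, e_c) e_b e_c psi),
   computed in the preferred trivialization at y *)
Definition dirac (psi : spinor_field) : spinor_field := fun y =>
  let e := frame_at y in
  \sum_a gam D a *m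
    (dfun (loc (btriv (spinors S) y) psi) y (e a y) +
     4^-1 *: \sum_b \sum_c
       form g (levi_civita g (e a) (e b)) (e c) y *:
         (gam D b *m gam D c *m psi y)).

Definition cliff1 (alpha : Y -> 'cV[R]_7 -> R) (psi : spinor_field) :
    spinor_field :=
  fun y => \sum_a alpha y (frame_at y a y) *: (gam D a *m psi y).

Definition cliff3 (H : Y -> 'cV[R]_7 -> 'cV[R]_7 -> 'cV[R]_7 -> R)
    (psi : spinor_field) : spinor_field := fun y =>
  let e a := frame_at y a y in
  \sum_(a < 7) \sum_(b < 7 | (a < b)%N) \sum_(c < 7 | (b < c)%N)
    H y (e a) (e b) (e c) *: (gam D a *m gam D b *m gam D c *m psi y).

(* positive generalized Dirac operator in the induced splitting *)
Definition gen_dirac (H : Y -> 'cV[R]_7 -> 'cV[R]_7 -> 'cV[R]_7 -> R)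
    (theta : Y -> 'cV[R]_7 -> R) (psi : spinor_field) : spinor_field :=
  fun y => dirac psi y + 4^-1 *: cliff3 H psi y - 2^-1 *: cliff1 theta psi y.

(* chi is a unit section, on a neighbourhood of y, of the field of lines L *)
Definition local_unit (L : Y -> set 'cV[R]_8) (y : Y) (chi : spinor_field) :=
  exists U, [/\ open U, U y, bsmooth (spinors S) U chi &
    forall z, U z ->
      beta D (chi z) (chi z) = 1 /\ L z = [set t *: chi z | t in [set: R]]].

End Dirac.

(* A density is given by its component in the preferred chart. *)
Definition positive_density (rho : Y -> R) : Prop :=
  (forall y, 0 < rho y) /\
  forall k, smooth (cdom k)
    ((fun y => rho y * `|\det (btrans (TY Y) (cat y) k y)|) : Y -> R).

Definition vol (g : Y -> 'M[R]_7) : Y -> R := fun y => Num.sqrt (\det (g y)).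

Record hull_configuration (D : spinor_module)
    n (B : bundle_data Y n) m (G : bundle_data Y m)
    (E : string_algebroid B G) := HullConfiguration {
  hmet :> admissible_metric E;
  (* the connection act (splitting X) equals nabla^g - 1/2 g^-1 H *)
  hull : forall U (X Z : vfield Y), open U ->
    bsmooth (TY Y) U X -> bsmooth (TY Y) U Z ->
    forall y (w : 'cV[R]_7), U y ->
      form (metric hmet)
        (act E (happ (splitting hmet) X) Z) (fun=> w) y =
      form (metric hmet) (levi_civita (metric hmet) X Z) (fun=> w) y
      - 2^-1 * flux hmet y (X y) (Z y) w;
  hspin : spin_structure D (metric hmet);
  hline : Y -> set 'cV[R]_8;
  hline_unit : forall y,
    exists chi : spinor_field hspin, local_unit hline y chi;
  hdens : Y -> R;
  hdens_pos : positive_density hdens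
}.

Section Functionals.
Variables (D : spinor_module).
Context n (B : bundle_data Y n) m (G : bundle_data Y m).
Context (E : string_algebroid B G).
Variable C : hull_configuration D E.

(* density = e^(-2 Phi) vol_g *)
Definition dilaton (y : Y) : R :=
  - 2^-1 * ln (hdens C y / vol (metric C) y).

(* a unit generator of the spinor line around y; it is unique up to sign, and
   the integrands below at y depend neither on the sign nor on the choice *)
Definition chi_at (y : Y) : spinor_field (hspin C) :=
  projT1 (cid (hline_unit C y)).

Definition zeta_at (y : Y) : spinor_field (hspin C) :=
  fun z => expR (- dilaton z) *: chi_at y z.

Definition theta (y : Y) (v : 'cV[R]_7) : R := 2 * dfun dilaton y v.

Definition W_Courant : \bar R :=
  integral_density (fun y =>
    hdens C y * beta D (chi_at y y)
                  (gen_dirac (flux C) theta (chi_at y) y)).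

Definition W_ext : \bar R :=
  integral_density (fun y =>
    (beta D (zeta_at y y) (dirac (zeta_at y) y) +
     4^-1 * beta D (zeta_at y y) (cliff3 (flux C) (zeta_at y) y)) *
    vol (metric C) y).

End Functionals.

End Spin.

Arguments spinor_module R : clear implicits.

(* Main.v *)
Require Import Defs.
From mathcomp Require Import perm.
From mathcomp Require Import all_boot all_order all_algebra.
From mathcomp Require Import all_classical all_reals all_analysis.

Set Implicit Arguments.
Unset Strict Implicit.
Unset Printing Implicit Defensive.

Import Order.TTheory GRing.Theory Num.Theory.
Import numFieldNormedType.Exports.

Local Open Scope classical_set_scope.
Local Open Scope ring_scope.

(* The two integrands agree at every point.  One-form Clifford multiplication is
   skew for the symmetric pairing beta, so beta(chi, alpha . chi) = 0 for every
   one-form alpha; this kills the theta term, and also the gradient term in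
   D_g (e^-Phi chi) = e^-Phi (D_g chi - dPhi . chi).  The remaining factors
   combine through e^(-2 Phi) vol_g = rho. *)

(** * Directional derivatives of products, determinants, logarithms and exponentials *)

Section Calculus.
Context {R : realType} {V : normedModType R}.
Implicit Types x v : V.

Lemma derive_scalel n (c : V -> R) (f : V -> 'cV[R]_n) x v :
  derivable c x v -> derivable f x v ->
  'D_v (fun z => c z *: f z) x = c x *: 'D_v f x + 'D_v c x *: f x.
Proof.
move=> dc df.
have dfi i : derivable (fun z => f z i 0 : R) x v.
  by have /derivable_mxP := df; apply.
have dci i : derivable (fun z => (c z *: f z) i 0 : R) x v.
  rewrite (_ : (fun z => _) = c * (fun z => f z i 0)); last first.
    by apply/funext => z; rewrite mxE.
  exact: derivableM.
rewrite derive_mx; last by apply/derivable_mxP => i j; rewrite (ord1 j); exact: dci.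
apply/colP => i; rewrite !mxE derive_mx// !mxE.
rewrite (_ : (fun z => _) = c * (fun z => f z i 0)); last first.
  by apply/funext => z; rewrite mxE.
by rewrite deriveM//; congr (_ + _); exact: mulrC.
Qed.

(** By the expansion over permutations the determinant is polynomial in the entries, so the sum and
    product rules suffice. *)
Lemma derivable_det n (M : V -> 'M[R]_n) x v :
  (forall i j, derivable (fun z => M z i j) x v) ->
  derivable (fun z => \det (M z)) x v.
Proof.
move=> dM.
have -> : (fun z => \det (M z)) =
    \sum_(s : 'S_n) (cst ((-1) ^+ s) * \prod_i (fun z => M z i (s i))).
  by apply/funext => z; rewrite fct_sumE; apply: eq_bigr => s _; rewrite /= fct_prodE.
elim/big_ind : _ => [|f g|s _]; [exact: derivable_cst|exact: derivableD|].
apply: derivableM; first exact: derivable_cst.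
by elim/big_ind : _ => [|f g|i _ //]; [exact: derivable_cst|exact: derivableM].
Qed.

(** Only a derivative along [v] is assumed, so [f] is first restricted to the line [h *: v + x]; in
    one variable derivability is differentiability and the chain rule applies. *)
Lemma derivable_ln_comp (f : V -> R) x v :
  derivable f x v -> 0 < f x -> derivable (fun z => ln (f z)) x v.
Proof.
move=> /derivable1P df fx.
apply/derivable1P/derivable1_diffP.
apply: (@differentiable_comp _ _ _ _ (fun h : R => f (h *: v + x)) (@ln R)).
  exact/derivable1_diffP.
apply/derivable1_diffP; rewrite scale0r add0r.
by have [] := is_derive1_ln fx.
Qed.

Lemma derivable_expR_comp (f : V -> R) x v :
  derivable f x v -> derivable (fun z => expR (f z)) x v.
Proof.
move=> /derivable1P df.
apply/derivable1P/derivable1_diffP.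
apply: (@differentiable_comp _ _ _ _ (fun h : R => f (h *: v + x)) (@expR R)).
  exact/derivable1_diffP.
exact/derivable1_diffP/derivable_expR.
Qed.

End Calculus.

(** * Passing between the manifold and its charts *)

Section Charts.
Context {R : realType} {Y : manifold R}.

Lemma cat_dom (y : Y) : cdom (Defs.cat y) y.
Proof. by rewrite /Defs.cat; case: ex_minnP => k /asboolP. Qed.

(** Lets identities valid on an open subset of [Y] be used under a derivative taken in the chart
    [k]. *)
Lemma near_cinv (U : set Y) k y : open U -> U y -> cdom k y ->
  \forall x \near chart k y,
    [/\ U (cinv k x), cdom k (cinv k x : Y) & chart k (cinv k x : Y) = x].
Proof.
move=> oU Uy ky.
have ky' : (@chart R Y k @` cdom k) (chart k y) by exists y.
have n1 : \forall x \near chart k y, (@chart R Y k @` cdom k) x.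
  by apply: open_nbhs_nbhs; split; first exact: chart_open.
have n2 : \forall x \near chart k y, U (cinv k x).
  apply: (cinv_continuous ky'); rewrite chartK//.
  by apply: open_nbhs_nbhs; split.
near=> x.
have [z kz zx] : (@chart R Y k @` cdom k) x by near: x.
have Ux : U (cinv k x) by near: x.
by split=> //; rewrite -zx chartK.
Unshelve. all: by end_near. Qed.

Lemma smooth_differentiable (W : normedModType R) (U : set Y) (f : Y -> W) k y :
  smooth U f -> U y -> cdom k y -> differentiable (f \o cinv k) (chart k y).
(* The empty list of partial derivatives stands for the function itself. *)
Proof. by move=> sf Uy ky; apply: (sf k [::]); exists y. Qed.

(** The two changes of charts compose to the identity near [chart i y], so by the chain rule their
    Jacobians are inverse to each other. *)
Lemma TY_btransV i j y : cdom i y -> cdom j y ->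
  btrans (TY Y) i j y *m btrans (TY Y) j i y = 1%:M.
Proof.
move=> iy jy.
pose f := @chart R Y i \o @cinv R Y j; pose g := @chart R Y j \o @cinv R Y i.
have gy : g (chart i y) = chart j y by rewrite /g /= chartK.
have df : differentiable f (g (chart i y)).
  by rewrite gy; apply: (@chart_smooth R Y j i [::]); exists y.
have dg : differentiable g (chart i y).
  by apply: (@chart_smooth R Y i j [::]); exists y.
have fg : {near chart i y, f \o g =1 id}.
  have := near_cinv (@cdom_open R Y j) jy iy; apply: filterS => x [jx _ xE].
  by rewrite /f /g /= chartK.
apply/matrixP => a b; rewrite !mxE.
(* Column [b] of the product of Jacobians is a combination of partial derivatives of [f]; linearity
   turns it into the differential of [f] applied to that of [g] at [delta_mx b 0]. *)
transitivity ((\sum_c ('D_(delta_mx b 0) g (chart i y)) c 0 *: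
    'D_(delta_mx c 0) f (chart j y)) a 0).
  by rewrite summxE; apply: eq_bigr => c _; rewrite !mxE mulrC.
under eq_bigr do rewrite -gy (deriveE _ df) (deriveE _ dg) -linearZ.
rewrite -linear_sum/=.
have -> : \sum_c ('d g (chart i y) (delta_mx b 0)) c 0 *: delta_mx c 0 =
    'd g (chart i y) (delta_mx b 0).
  rewrite [RHS]matrix_sum_delta; apply: eq_bigr => c _.
  by rewrite big_ord1.
have -> : 'd f (g (chart i y)) ('d g (chart i y) (delta_mx b 0)) =
    ('d f (g (chart i y)) \o 'd g (chart i y)) (delta_mx b 0) by [].
rewrite -diff_comp// -deriveE; last exact: differentiable_comp.
by rewrite (near_eq_derive _ fg) derive_id mxE eqxx andbT.
Qed.

End Charts.

(** * Spinor pairing, Riemannian volume and the Dirac operator *)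

Section Spinors.
Context {R : realType} {Y : manifold R} (D : spinor_module R).

Lemma betaDr (u v w : 'cV[R]_8) : beta D u (v + w) = beta D u v + beta D u w.
Proof. by rewrite /beta mulmxDr mxE. Qed.

Lemma betaZr c (u v : 'cV[R]_8) : beta D u (c *: v) = c * beta D u v.
Proof. by rewrite /beta -scalemxAr mxE. Qed.

Lemma betaZl c (u v : 'cV[R]_8) : beta D (c *: u) v = c * beta D u v.
Proof. by rewrite /beta linearZ/= -!scalemxAl mxE. Qed.

(** Since [bet D] is symmetric and [gam D a] is skew for it, the transpose of this 1 by 1 matrix is
    its negative, so its entry vanishes. *)
Lemma beta_gam (a : 'I_7) (u : 'cV[R]_8) : beta D u (gam D a *m u) = 0.
Proof.
rewrite /beta; set X := _ *m _.
have XT : X^T = - X.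
  rewrite /X !trmx_mul trmxK bet_sym -mulmxA (mulmxA (gam D a)^T) gam_skew.
  by rewrite mulNmx mulmxN -!mulmxA.
have /eqP := congr1 (fun A : 'M[R]_1 => A 0 0) XT.
by rewrite !mxE -addr_eq0 -mulr2n mulrn_eq0 => /eqP.
Qed.

Variables (g : Y -> 'M[R]_7) (S : spin_structure D g).

Definition frame_mx (j : bidx (spinors S)) (z : Y) : 'M[R]_7 :=
  \matrix_(a, b) frame j b z a 0.

Lemma frame_mx_on j z : bdom (spinors S) j z ->
  (frame_mx j z)^T *m g z *m frame_mx j z = 1%:M.
Proof.
move=> jz; apply/matrixP => a b; rewrite [RHS]mxE -(@frame_on _ _ _ _ S j a b z jz).
rewrite /Defs.form !mxE; apply: eq_bigr => c _; congr (_ * _); rewrite !mxE//.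
by apply: eq_bigr => d _; rewrite !mxE.
Qed.

(** Take determinants in the orthonormality relation [frame_mx_on]. The absolute value is needed
    because the sign of the frame determinant is not fixed in the preferred charts. *)
Lemma vol_frame j z : bdom (spinors S) j z ->
  \det (frame_mx j z) != 0 /\ vol g z = `|\det (frame_mx j z)|^-1.
Proof.
move=> /frame_mx_on /(congr1 (fun M => \det M)).
rewrite !det_mulmx det_tr det1 => dE.
have F0 : \det (frame_mx j z) != 0.
  by apply: contra_eq_neq dE => ->; rewrite mulr0 eq_sym oner_eq0.
split=> //; rewrite /vol -normfV -sqrtr_sqr; congr Num.sqrt.
apply: (mulfI F0); apply: (mulIf F0); rewrite dE.
by rewrite exprVn expr2 invfM mulrA divff// mul1r mulVf.
Qed.

Lemma vol_gt0 z : 0 < vol g z.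
Proof.
have [_ dom _ _ _] := sp_bundle S.
by have [F0 ->] := vol_frame (dom z); rewrite invr_gt0 normr_gt0.
Qed.

(* In a local orthonormal frame with matrix F, vol g = 1 / |det F|.  In the
   preferred charts neither [rho] nor [det F] need be continuous, but read in a
   fixed chart k both are differentiable, and the Jacobians relating the two
   readings cancel in [rho / vol g = rho * |det F|]. *)
Lemma derivable_ln_dens_vol (rho : Y -> R) y v : positive_density rho ->
  derivable ((fun z => ln (rho z / vol g z)) \o @cinv R Y (Defs.cat y))
    (@chart R Y (Defs.cat y) y) v.
Proof.
move=> [rho0 rhoS]; set k := Defs.cat y; set j := btriv (spinors S) y.
have ky : cdom k y := cat_dom y.
have [odom dom _ _ _] := sp_bundle S.
have jy : bdom (spinors S) j y := dom y.
pose T z := btrans (TY Y) (Defs.cat z) k z.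
pose T' z := btrans (TY Y) k (Defs.cat z) z.
pose h z := rho z * `|\det (T z)|.
pose M z : 'M[R]_7 := T' z *m frame_mx j z.
have T'T z : cdom k z -> \det (T' z) * \det (T z) = 1.
  by move=> kz; rewrite -det_mulmx TY_btransV ?det1//; exact: cat_dom.
have h0 z : cdom k z -> 0 < h z.
  move=> /T'T TT; rewrite mulr_gt0// normr_gt0.
  by apply: contra_eq_neq TT => ->; rewrite mulr0 eq_sym oner_eq0.
have M0 z : cdom k z -> bdom (spinors S) j z -> \det (M z) != 0.
  move=> /T'T TT /vol_frame [F0 _]; rewrite det_mulmx mulf_neq0//.
  by apply: contra_eq_neq TT => ->; rewrite mul0r eq_sym oner_eq0.
(* Half the logarithm of the square stands for the logarithm of the absolute value of [\det (M z)],
   which avoids differentiating an absolute value. *)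
have lnE z : cdom k z -> bdom (spinors S) j z ->
    ln (h z) + 2^-1 * ln (\det (M z) ^+ 2) = ln (rho z / vol g z).
  move=> kz jz; have [F0 ->] := vol_frame jz.
  rewrite -real_normK ?num_real// lnXn ?normr_gt0 ?M0//.
  rewrite -(mulr_natl (ln _)) mulrA mulVf ?pnatr_eq0// mul1r.
  rewrite -lnM ?posrE ?h0 ?normr_gt0 ?M0// invrK; congr ln.
  rewrite /h /M det_mulmx normrM -!mulrA; congr (_ * _); rewrite mulrA -normrM.
  by rewrite [X in `|X|]mulrC T'T// normr1 mul1r.
have nE : {near chart k y, (fun x => ln (h (cinv k x)) +
    2^-1 * ln (\det (M (cinv k x)) ^+ 2)) =1
    (fun z => ln (rho z / vol g z)) \o cinv k}.
  have := near_cinv (odom j) jy ky; apply: filterS => x [jx kx _].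
  exact: lnE.
apply: (near_eq_derivable nE).
apply: derivableD.
  apply: derivable_ln_comp; last by rewrite chartK//; exact: h0.
  by apply: diff_derivable; exact: (smooth_differentiable (rhoS k)).
apply: (@derivableZ _ _ _ _ 2^-1).
apply: derivable_ln_comp; last by rewrite chartK// exprn_even_gt0//= M0.
apply: (@derivableX _ _ _ 2).
apply: derivable_det => a b.
(* The columns of [M] are the frame fields read in the fixed chart [k], which is where
   [frame_smooth] gives differentiability. *)
have ME z : M z a b = loc (k : bidx (TY Y)) (frame j b) z a 0.
  rewrite /M /loc -/(T' z); move: (T' z) => A.
  by rewrite !mxE; apply: eq_bigr => c _; rewrite [frame_mx j z c b]mxE.
have /derivable_mxP/(_ a 0) : derivable
    (loc (k : bidx (TY Y)) (frame j b) \o cinv k) (chart k y) v.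
  apply: diff_derivable.
  have /smooth_differentiable := @frame_smooth _ _ _ _ S j b (k : bidx (TY Y)).
  by apply=> //; split.
by apply: near_eq_derivable; near=> x; rewrite -ME.
Unshelve. all: by end_near. Qed.

Lemma beta_cliff1 al (psi : spinor_field S) y :
  beta D (psi y) (cliff1 al psi y) = 0.
Proof.
rewrite /beta /cliff1 mulmx_sumr summxE big1// => a _.
by rewrite -scalemxAr mxE; have := beta_gam a (psi y); rewrite /beta => ->; rewrite mulr0.
Qed.

Lemma cliff3Z H (c : Y -> R) (psi : spinor_field S) y :
  cliff3 (S := S) H (fun z => c z *: psi z : 'cV[R]_8) y = c y *: cliff3 H psi y.
Proof.
rewrite /cliff3 scaler_sumr; apply: eq_bigr => a _.
rewrite scaler_sumr; apply: eq_bigr => b _.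
rewrite scaler_sumr; apply: eq_bigr => d _.
by rewrite -scalemxAr !scalerA mulrC.
Qed.

Lemma locZ j (c : Y -> R) (psi : spinor_field S) :
  loc (B := spinors S) j (fun z => c z *: psi z : 'cV[R]_8) =
  (fun z => c z *: loc j psi z).
Proof. by apply/funext => z; rewrite /loc -scalemxAr. Qed.

(* The gradient term of the Leibniz rule is [dc . psi], which [beta D (psi y)]
   annihilates because one-form Clifford multiplication is skew. *)
Lemma beta_diracZ U (c : Y -> R) (psi : spinor_field S) y :
  bsmooth (spinors S) U psi -> U y ->
  (forall v, derivable (c \o cinv (Defs.cat y)) (@chart R Y (Defs.cat y) y) v) ->
  beta D (psi y) (Defs.dirac (S := S) (fun z => c z *: psi z : 'cV[R]_8) y) =
  c y * beta D (psi y) (Defs.dirac psi y).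
Proof.
move=> psiS Uy dc.
have [_ dom _ btr1 _] := sp_bundle S.
set j := btriv (spinors S) y.
have dpsi v : derivable (loc j psi \o cinv (Defs.cat y)) (@chart R Y (Defs.cat y) y) v.
  apply: diff_derivable.
  exact: (smooth_differentiable (psiS j) (conj Uy (dom y)) (cat_dom y)).
have locy : loc j psi y = psi y by rewrite /loc btr1 ?mul1mx//; exact: dom.
have dE v : dfun (loc (B := spinors S) j (fun z => c z *: psi z : 'cV[R]_8)) y v =
    c y *: dfun (loc j psi) y v + dfun c y v *: psi y.
  rewrite locZ /dfun.
  have := derive_scalel (dc v) (dpsi v).
  by rewrite /= chartK; [rewrite locy|exact: cat_dom].
rewrite /beta /Defs.dirac !mulmx_sumr !summxE mulr_sumr; apply: eq_bigr => a _.
rewrite -/j dE.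
set P := \sum_b _; set Q := \sum_b _.
(* The spin connection term is of order zero, so [c y] factors out; only the derivative term yields
   a gradient. *)
have -> : P = c y *: Q.
  rewrite scaler_sumr; apply: eq_bigr => b _; rewrite scaler_sumr.
  by apply: eq_bigr => d _; rewrite -scalemxAr !scalerA mulrC.
rewrite addrAC [4^-1 *: _]scalerA [4^-1 * _]mulrC -scalerA -scalerDr.
rewrite !mulmxDr -!scalemxAr [LHS]mxE [X in X + _]mxE [X in _ + X]mxE.
by have := beta_gam a (psi y); rewrite /beta => ->; rewrite mulr0 addr0 !mulmxDr -!scalemxAr.
Qed.

End Spinors.

(** * Pointwise equality of the two densities *)

Theorem proposition4p1 (R : realType) (Y : manifold R) (D : spinor_module R)
    (n : nat) (B : bundle_data Y n) (m : nat) (G : bundle_data Y m)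
    (E : string_algebroid B G) (C : hull_configuration D E) :
  W_Courant C = W_ext C.
Proof.
rewrite /W_Courant /W_ext; congr integral_density; apply/funext => y.
rewrite /zeta_at; set chi := chi_at C y.
have [U [_ Uy chiS _]] : local_unit (@hline _ _ _ _ _ _ _ _ C) y chi.
  exact: projT2 (cid (hline_unit C y)).
have dc v : derivable ((fun z => expR (- dilaton C z)) \o cinv (Defs.cat y))
    (@chart R Y (Defs.cat y) y) v.
  apply: derivable_expR_comp; apply: derivableN.
  apply: (@derivableZ _ _ _ _ (- 2^-1)).
  exact: derivable_ln_dens_vol (hspin C) _ _ _ (hdens_pos C).
have v0 : 0 < vol (metric C) y := vol_gt0 (hspin C) y.
have [r0 _] := hdens_pos C; move/(_ y) in r0.
(* The factor [- 2^-1] in [dilaton] makes the two exponents add up to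
   [ln (hdens C y / vol (metric C) y)]. *)
have cE : expR (- dilaton C y) * expR (- dilaton C y) * vol (metric C) y =
    hdens C y.
  rewrite -expRD /dilaton -opprD -mulrDl -opprD -div1r -splitr mulN1r opprK.
  by rewrite lnK ?posrE ?divr_gt0// divfK// gt_eqF.
set c := fun z : Y => expR (- dilaton C z).
have -> : hdens C y = c y * c y * vol (metric C) y by [].
rewrite [LHS]mulrAC; congr (_ * _).
(* Each slot of the pairing contributes one factor [c y], matching [c y * c y] on the other side. *)
rewrite !betaZl (beta_diracZ chiS Uy dc) (cliff3Z _ c) betaZr.
rewrite /gen_dirac -scaleNr !betaDr !betaZr beta_cliff1.
rewrite mulr0 addr0 mulrDr -!mulrA; congr (_ + _).
by rewrite [RHS]mulrCA; congr (_ * _); exact: mulrCA.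
Qed.
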